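(* There is an absolute constant $N$ such that every 5-vertex-critical $(P_5,\text{chair})$-free graph that contains an induced $C_5$ has at most $N$ vertices.
   Context: All graphs are finite and simple. $P_t$ denotes the path on $t$ vertices and $C_5$ the cycle on 5 vertices. The chair is the 5-vertex graph obtained from a path $P_4$ by adding one new vertex adjacent to exactly one of the two middle vertices of the $P_4$. A graph $G$ is $(H_1,H_2)$-free if it contains no induced subgraph isomorphic to $H_1$ or to $H_2$. A graph $G$ is $k$-vertex-critical if $\chi(G)=k$ and $\chi(G-v)<k$ for every vertex $v\in V(G)$. *)

(* Defs.v *)
From mathcomp Require Import all_boot.
Set Implicit Arguments. Unset Strict Implicit. Unset Printing Implicit Defensive.

Record sgraph (T : finType) := SGraph {
  adj : rel T;
  adj_sym : symmetric adj;
  adj_irr : irreflexive adj }.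

Definition colorable (T : finType) (G : sgraph T) (A : {set T}) (k : nat) : bool :=
  [exists c : {ffun T -> 'I_k},
     [forall x in A, forall y in A, adj G x y ==> (c x != c y)]].

Lemma colorable_exists (T : finType) (G : sgraph T) (A : {set T}) :
  exists k, colorable G A k.
Proof.
exists #|T|; apply/existsP; exists [ffun x => enum_rank x].
apply/forallP => x; apply/implyP => _; apply/forallP => y; apply/implyP => _.
apply/implyP => Hxy; rewrite !ffunE.
apply/negP => /eqP /enum_rank_inj Exy; subst y.
by rewrite (adj_irr G) in Hxy.
Qed.

Definition chi (T : finType) (G : sgraph T) (A : {set T}) : nat :=
  ex_minn (colorable_exists G A).

Definition vertex_critical (T : finType) (G : sgraph T) (k : nat) : Prop :=
  chi G [set: T] = k /\ forall v : T, chi G [set~ v] < k.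

Definition contains_induced (T : finType) (G : sgraph T) (n : nat) (h : rel 'I_n) : Prop :=
  exists f : 'I_n -> T, injective f /\ forall i j, adj G (f i) (f j) = h i j.

Definition P5 : rel 'I_5 := fun i j => (i.+1 == j :> nat) || (j.+1 == i :> nat).
Definition C5 : rel 'I_5 :=
  fun i j => (i.+1 %% 5 == j :> nat) || (j.+1 %% 5 == i :> nat).
Definition chair_edge (a b : nat) : bool :=
  [|| (a == 0) && (b == 1), (a == 1) && (b == 2), (a == 2) && (b == 3)
    | (a == 1) && (b == 4)].
Definition chair : rel 'I_5 := fun i j => chair_edge i j || chair_edge j i.

(* Main.v *)
Require Import Defs.
From mathcomp Require Import all_boot perm.
Set Implicit Arguments. Unset Strict Implicit. Unset Printing Implicit Defensive.

(* Let C be an induced 5-cycle.  A vertex z off C sees either nothing of C or at least three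
   of its vertices; F is the set of vertices seeing all of C.  Vertices seeing nothing of C
   can be recolored away, so none exist.  For any other trace S on C, let Y be the set of
   vertices off C with trace S.  Vertices off C, outside F, whose trace strictly contains S
   are complete to Y, and the others outside Y and F miss some c in C that is complete to Y.
   - If c is complete to an independent set I and z misses c, then (chair) z sees nothing of I
     or misses at most one vertex of I.  When every vertex outside I behaves like this,
     incomparability of neighborhoods gives each x in I a private z missing only x; by
     P5-freeness these z form a clique, so |I| <= 4.  This bounds F and the degrees in G[Y].
   - Components of G[Y] have diameter at most 3 by P5-freeness, hence bounded size.  They are
     bipartite, and the trace on F of a vertex depends only on its component and its side.
     Among many components, five have the same traces on F; if one cannot be folded onto an
     edge of another, some vertex outside Y and F distinguishes them, and the clique
     argument applies to components in place of vertices. *)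

(** * Counting, connectivity and pigeonhole on finite types *)

Lemma card_fibers_le (aT rT : finType) (f : aT -> rT) (A : {set aT}) m :
  (forall y, #|[set x in A | f x == y]| <= m) -> #|A| <= #|f @: A| * m.
Proof.
move=> fib; rewrite -sum1_card (partition_big_imset f) /= -sum_nat_const.
apply: leq_sum => y _; rewrite sum1dep_card; exact: fib.
Qed.

Lemma card_family_le (aT rT : finType) (A : {set aT}) (K : aT -> {set rT}) m :
  (forall x, x \in A -> #|K x| <= m) -> #|\bigcup_(x in A) K x| <= #|A| * m.
Proof.
move=> Km; rewrite -sum_nat_const.
elim/big_rec2: _ => [|x s B Ax IH]; first by rewrite cards0.
by apply: leq_trans (leq_card_setU _ _) _; rewrite leq_add ?Km.
Qed.

Lemma ord_enum_of_card (T : finType) (A : {set T}) n :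
  n <= #|A| -> exists2 f : 'I_n -> T, injective f & forall i, f i \in A.
Proof.
move=> nA; exists (fun i => enum_val (widen_ord nA i)).
  by move=> i j /enum_val_inj /(congr1 val) /= /val_inj.
by move=> i; apply: enum_valP.
Qed.

Lemma connect_invariant (T : finType) (r : rel T) (P : pred T) x y :
  P x -> (forall u v, P u -> r u v -> P v) -> connect r x y -> P y.
Proof.
move=> Px stepP /connectP[p]; elim: p x Px => [|z p IH] x Px /=; first by move=> _ ->.
by case/andP=> /(stepP _ _ Px) Pz /(IH _ Pz).
Qed.

Lemma exists_ord5_neq2 (a b : 'I_5) : exists d : 'I_5, (d != a) && (d != b).
Proof.
have : 0 < #|~: [set a; b]|.
  have := cardsC [set a; b]; rewrite card_ord cards2.
  by case: (a == b) => /=; case: #|_|.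
by case/card_gt0P=> d; rewrite !inE negb_or; exists d.
Qed.

(** Excluding [d1] and [d2] leaves two of the four colors, so of two distinct remaining values
    exactly one is [a]. *)
Lemma ord4_two_left (d1 d2 a x y : 'I_4) :
  d1 != d2 -> d1 != a -> d2 != a -> d1 != x -> d2 != x -> d1 != y -> d2 != y -> x != y ->
  (x == a) != (y == a).
Proof.
move=> n12 n1a n2a n1x n2x n1y n2y nxy.
have : ~~ uniq [:: d1; d2; a; x; y].
  by apply/negP => /card_uniqP us; have := max_card (mem [:: d1; d2; a; x; y]); rewrite us card_ord.
rewrite /= !inE !negb_or n12 n1a n2a n1x n2x n1y n2y nxy /= !(eq_sym a).
by case: (x =P a) nxy => [->|_]; case: (y =P a) => [->|_]; rewrite //= ?eqxx.
Qed.

(** * Induced subgraphs and colorings *)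

Lemma induced_P5 (T : finType) (G : sgraph T) (a b c d f : T) :
  adj G a b -> adj G b c -> adj G c d -> adj G d f ->
  ~~ adj G a c -> ~~ adj G a d -> ~~ adj G a f ->
  ~~ adj G b d -> ~~ adj G b f -> ~~ adj G c f ->
  contains_induced G P5.
Proof.
move=> ab bc cd df /negbTE ac /negbTE ad /negbTE af /negbTE bd /negbTE bf /negbTE cf.
pose g (i : 'I_5) := nth a [:: a; b; c; d; f] i.
have gE i j : adj G (g i) (g j) = P5 i j.
  case: i j => [[|[|[|[|[|//]]]]] ?] [[|[|[|[|[|//]]]]] ?]; rewrite /g /P5 /= ?adj_irr //;
  by rewrite // adj_sym.
(* Distinct vertices of a P5 have distinct neighborhoods, so the adjacencies alone give
   injectivity. *)
exists g; split=> // i j gij.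
have row k : P5 i k = P5 j k by rewrite -!gE gij.
have := (row (inord 0), row (inord 1), row (inord 2), row (inord 3), row (inord 4)).
rewrite /P5 !inordK //.
by case: i j {gij row} => [[|[|[|[|[|//]]]]] ?] [[|[|[|[|[|//]]]]] ?] /= [[[[? ?] ?] ?] ?] //;
   apply: val_inj.
Qed.

(** The leaves [a] and [f] have the same neighbor in the chair, so adjacency separates every pair of
    vertices but this one. *)
Lemma induced_chair (T : finType) (G : sgraph T) (a b c d f : T) :
  adj G b a -> adj G b f -> adj G b c -> adj G c d -> a != f ->
  ~~ adj G a f -> ~~ adj G a c -> ~~ adj G f c ->
  ~~ adj G d a -> ~~ adj G d b -> ~~ adj G d f ->
  contains_induced G chair.
Proof.
move=> ba bf bc cd Naf /negbTE af /negbTE ac /negbTE fc /negbTE da /negbTE db /negbTE df.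
pose g (i : 'I_5) := nth a [:: a; b; c; d; f] i.
have gE i j : adj G (g i) (g j) = chair i j.
  case: i j => [[|[|[|[|[|//]]]]] ?] [[|[|[|[|[|//]]]]] ?]; rewrite /g /chair /= ?adj_irr //;
  by rewrite // adj_sym.
exists g; split=> // i j gij.
have row k : chair i k = chair j k by rewrite -!gE gij.
have := (row (inord 0), row (inord 1), row (inord 2), row (inord 3), row (inord 4)).
rewrite /chair !inordK //.
case: i j gij {row} => [[|[|[|[|[|//]]]]] ?] [[|[|[|[|[|//]]]]] ?] gij /= [[[[? ?] ?] ?] ?] //;
  try by apply: val_inj.
  by move: Naf; rewrite /g /= in gij *; rewrite gij eqxx.
by move: Naf; rewrite /g /= in gij *; rewrite gij eqxx.
Qed.

Lemma colorableP (T : finType) (G : sgraph T) (A : {set T}) k :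
  reflect (exists c : T -> 'I_k, forall x y, x \in A -> y \in A -> adj G x y -> c x != c y)
          (colorable G A k).
Proof.
apply: (iffP existsP) => [[c /forall_inP cP]|[c cP]].
  by exists c => x y xA yA xy; move/forall_inP/(_ y yA): (cP x xA); rewrite xy.
exists (finfun c); apply/forall_inP => x xA; apply/forall_inP => y yA.
by rewrite !ffunE; apply/implyP; apply: cP.
Qed.

Lemma colorable_leq (T : finType) (G : sgraph T) (A : {set T}) k l :
  k <= l -> colorable G A k -> colorable G A l.
Proof.
move=> kl /colorableP[c cP]; apply/colorableP; exists (widen_ord kl \o c) => x y xA yA xy.
by apply: contraNneq (cP x y xA yA xy) => /= /(congr1 val) /= /val_inj ->.
Qed.

Lemma chi_leq (T : finType) (G : sgraph T) (A : {set T}) k :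
  (chi G A <= k) = colorable G A k.
Proof.
rewrite /chi; case: ex_minnP => n cn minn; apply/idP/idP => [nk|/minn //].
exact: colorable_leq cn.
Qed.

(** * Consequences of 5-vertex-criticality *)

Section CriticalGraph.

Variables (T : finType) (G : sgraph T).
Hypothesis critG : vertex_critical G 5.
Hypothesis noP5 : ~ contains_induced G P5.
Hypothesis noChair : ~ contains_induced G chair.

Local Notation "x -- y" := (adj G x y) (at level 30).

Let symG : symmetric (adj G) := @adj_sym T G.

Lemma coloring_off v :
  exists c : T -> 'I_4, forall x y, x != v -> y != v -> x -- y -> c x != c y.
Proof.
have /colorableP[c cP] : colorable G [set~ v] 4 by rewrite -chi_leq -ltnS; case: critG.
by exists c => x y xv yv; apply: cP; rewrite !inE.
Qed.

Lemma not_4colorable (c : T -> 'I_4) :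
  (forall x y, x -- y -> c x != c y) -> False.
Proof.
move=> cP; suff: chi G setT <= 4 by case: critG => ->.
by rewrite chi_leq; apply/colorableP; exists c => x y _ _; apply: cP.
Qed.

Lemma no_clique5 v (s : seq T) :
  size s = 5 -> v \notin s -> pairwise (adj G) s -> False.
Proof.
move=> s5 vs pws; have [c cP] := coloring_off v.
have : uniq (map c s).
  rewrite uniq_pairwise pairwise_map.
  apply: (sub_in_pairwise (P := [in s])) pws; last by apply/allP.
  by move=> x y xs ys; apply: cP; apply: contraNneq vs => <-.
by move/card_uniqP=> cs; have := max_card (mem (map c s)); rewrite cs size_map s5 card_ord.
Qed.

(** Take a 4-coloring of the graph without [x] and recolor each [u] in [K] with the color of [f u].
    If [f] also kept all edges leaving [K], the whole graph would be 4-colored. *)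
Lemma critical_no_hom (K : {set T}) (f : T -> T) x :
  x \in K -> (forall u, u \in K -> f u \notin K) ->
  (forall u v, u \in K -> v \in K -> u -- v -> f u -- f v) ->
  exists u z, [/\ u \in K, z \notin K, u -- z & ~~ f u -- z].
Proof.
move=> xK fK homf; have [c cP] := coloring_off x.
have [/exists_inP[u uK /exists_inP[z zK /andP[uz fuz]]]|noz] :=
  boolP [exists u in K, exists z in ~: K, (u -- z) && ~~ (f u -- z)].
  by exists u, z; rewrite inE in zK.
have mono u z : u \in K -> z \notin K -> u -- z -> f u -- z.
  move=> uK zK uz; apply: contraNT noz => fuz; apply/exists_inP; exists u => //.
  by apply/exists_inP; exists z; rewrite ?inE // uz.
have neq u : u \notin K -> u != x by apply: contraNneq => ->.
case: (@not_4colorable (fun u => if u \in K then c (f u) else c u)) => u v.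
case: ifP => uK; case: ifP => vK uv.
- by apply: cP; rewrite ?neq ?fK ?homf.
- by apply: cP; rewrite ?neq ?fK ?mono ?vK.
- by rewrite eq_sym; apply: cP; rewrite ?neq ?fK ?mono ?uK // symG.
by apply: cP; rewrite ?neq ?uK ?vK.
Qed.

Lemma critical_private_neighbor x y : x != y -> ~~ x -- y -> exists2 z, x -- z & ~~ y -- z.
Proof.
move=> xy nxy; have [||u v|u [z []]] := @critical_no_hom [set x] (fun=> y) x.
- by rewrite inE.
- by move=> u _; rewrite inE eq_sym.
- by rewrite !inE => /eqP-> /eqP->; rewrite adj_irr.
by rewrite inE => /eqP-> _; exists z.
Qed.

(* Nonadjacent [z a], [z b] would give the induced path [v a, z b, v d, z a, v b],
   so the [z a] form a clique on five vertices. *)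
Lemma no_co_matching (v z : 'I_5 -> T) :
  (forall a b, ~~ v a -- v b) -> (forall a b, z a -- v b = (a != b)) -> False.
Proof.
move=> vv zv; apply: (@no_clique5 (v ord0) (codom z)).
- by rewrite size_codom card_ord.
- apply/codomP => -[b v0]; have [d /andP[db d0]] := exists_ord5_neq2 b ord0.
  by have := zv b d; rewrite -v0 (negbTE (vv _ _)) eq_sym db.
rewrite /codom /image_mem pairwise_map.
have := enum_uniq 'I_5; rewrite uniq_pairwise; apply: sub_pairwise => a b ab /=.
apply: contraPT noP5 => zab; have [d /andP[da db]] := exists_ord5_neq2 a b.
move=> []; apply: (@induced_P5 _ _ (v a) (z b) (v d) (z a) (v b)) => //.
- by rewrite symG zv eq_sym.
- by rewrite zv eq_sym.
- by rewrite symG zv eq_sym.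
- by rewrite zv.
- by rewrite symG zv negbK.
- by rewrite symG.
- by rewrite zv negbK.
Qed.

(** On an independent set, [z] sees nothing or misses at most one vertex. The form with triples also
    makes sense when [I] has edges, and passes to subsets. *)
Definition almost_uniform (I : {set T}) z :=
  forall u v w, u \in I -> v \in I -> w \in I -> u != v -> u != w -> v != w ->
    ~~ u -- v -> ~~ u -- w -> ~~ v -- w -> z -- u -> z -- v || z -- w.

Lemma almost_uniform_chair (I : {set T}) c z :
  (forall u, u \in I -> c -- u) -> ~~ z -- c -> almost_uniform I z.
Proof.
move=> cI zc u v w uI vI wI uv uw vw nuv nuw nvw zu.
apply: contraPT noChair; rewrite negb_or => /andP[zv zw] [].
by apply: (@induced_chair _ _ v c u z w); rewrite ?cI // symG.
Qed.

Lemma almost_uniform_const (I : {set T}) z b :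
  (forall u, u \in I -> z -- u = b) -> almost_uniform I z.
Proof. by move=> zI u v w uI vI wI _ _ _ _ _ _; rewrite !zI // => ->. Qed.

Lemma independent_le4 (I : {set T}) :
  {in I &, forall x y, ~~ x -- y} ->
  (forall z, z \notin I -> almost_uniform I z) -> #|I| <= 4.
Proof.
move=> indI auI; rewrite leqNgt; apply/negP => /ord_enum_of_card[x injx xI].
have xx a b : ~~ x a -- x b by apply: indI.
have /fin_all_exists[z zP] b : exists z, forall d, z -- x d = (b != d).
  (* Incomparability gives [z] seeing [x a] and missing [x b]; almost uniformity then makes it see
     all the others. *)
  have [a /andP[ab _]] := exists_ord5_neq2 b b.
  have [|z xaz xbz] := @critical_private_neighbor (x a) (x b) _ (xx _ _).
    by rewrite (inj_eq injx).
  exists z => d; have [<-|bd] := eqVneq b d; first by rewrite symG; apply/negbTE.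
  have [->|da] := eqVneq d a; first by rewrite symG.
  have zI : z \notin I.
    by apply: contraTN xaz => zI; apply: indI.
  have := auI z zI (x a) (x d) (x b); rewrite !(inj_eq injx) [z -- x b]symG (negbTE xbz) orbF.
  by apply; rewrite // 1?eq_sym 1?symG // eq_sym.
exact: (@no_co_matching x z).
Qed.

(** * The class of vertices with one fixed trace on the cycle *)

Section NeighborhoodClass.

(** To be used with [c1], [c2] adjacent cycle vertices in the trace defining [Y], [t] a cycle vertex
    outside it, and [F] the vertices complete to the cycle. *)
Variables (F Y : {set T}) (c1 c2 t : T).
Hypothesis c12 : c1 -- c2.
Hypothesis c1F : forall f, f \in F -> c1 -- f.
Hypothesis c2F : forall f, f \in F -> c2 -- f.
Hypothesis tF : forall f, f \in F -> t -- f.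
Hypothesis c1Y : forall y, y \in Y -> c1 -- y.
Hypothesis c2Y : forall y, y \in Y -> c2 -- y.
Hypothesis tY : forall y, y \in Y -> ~~ t -- y.
Hypothesis tNY : t \notin Y.
Hypothesis auY : forall z, z \notin Y -> z \notin F -> almost_uniform Y z.
Hypothesis F4 : #|F| <= 4.

(** With [c1] and [c2] the triangle would be a clique on five vertices avoiding [t]. *)
Lemma class_no_triangle x y z :
  x \in Y -> y \in Y -> z \in Y :|: F -> x -- y -> y -- z -> x -- z -> False.
Proof.
move=> xY yY zYF xy yz xz; apply: (@no_clique5 t [:: c1; c2; x; y; z]) => //.
  have neq c : c -- x -> t != c by apply: contraTneq => <-; apply: tY.
  have neqY w : w \in Y -> t != w by apply: contraTneq => <-.
  rewrite !inE (negbTE (neq _ (c1Y xY))) (negbTE (neq _ (c2Y xY))).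
  rewrite (negbTE (neqY _ xY)) (negbTE (neqY _ yY)) /=.
  case/setUP: zYF => [/neqY //|/tF]; by apply: contraTneq => <-; rewrite adj_irr.
have [c1z c2z] : c1 -- z /\ c2 -- z by case/setUP: zYF => ?; split; auto.
by rewrite /= c12 c1z c2z xy xz yz !(c1Y xY, c1Y yY, c2Y xY, c2Y yY).
Qed.

Let N x := [set y in Y | x -- y].

(** The neighborhood is independent for lack of triangles. A nonneighbor of [x] is almost uniform on
    it by the chair centered at [x], and a neighbor of [x] in [F] sees none of it. *)
Lemma class_degree x : x \in Y -> #|N x| <= 4.
Proof.
move=> xY; have NP u : u \in N x -> (u \in Y) /\ x -- u by rewrite inE => /andP.
apply: independent_le4 => [u v /NP[uY xu] /NP[vY xv]|z zN].
  by apply/negP => uv; apply: (class_no_triangle xY uY _ xu uv xv); rewrite inE vY.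
have [xz|xz] := boolP (x -- z); last first.
  by apply: (@almost_uniform_chair _ x) => [u /NP[]|]; rewrite // symG.
have zY : z \notin Y by apply: contra zN; rewrite inE xz => ->.
have [zF|zF] := boolP (z \in F).
  apply: (@almost_uniform_const _ _ false) => u /NP[uY xu].
  by apply/negP => zu; apply: (class_no_triangle xY uY _ xu _ xz); rewrite ?inE ?zF ?orbT // symG.
by move=> u v w /NP[uY _] /NP[vY _] /NP[wY _]; apply: auY.
Qed.

Let ball n x := iter n (fun B : {set T} => \bigcup_(u in B) (u |: N u)) [set x].

Lemma ballS n x u : u \in ball n x -> u \in ball n.+1 x.
Proof. by move=> ux; apply/bigcupP; exists u; rewrite // !inE eqxx. Qed.

Lemma ball_step n x u v : u \in ball n x -> v \in Y -> u -- v -> v \in ball n.+1 x.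
Proof. by move=> ux vY uv; apply/bigcupP; exists u; rewrite // !inE vY uv orbT. Qed.

Lemma ball_sub n x u : x \in Y -> u \in ball n x -> u \in Y.
Proof.
move=> xY; elim: n u => [|n IH] u; first by rewrite inE => /eqP->.
by case/bigcupP=> v /IH vY; rewrite !inE => /orP[/eqP->|/andP[]].
Qed.

Lemma ball_card n x : x \in Y -> #|ball n x| <= 5 ^ n.
Proof.
move=> xY; elim: n => [|n IH]; first by rewrite cards1.
rewrite expnSr; apply: leq_trans (leq_mul IH (leqnn 5)); apply: card_family_le => u uB.
by rewrite cardsU1 -(add1n 4) leq_add ?leq_b1 // class_degree // (ball_sub xY uB).
Qed.

(** The last clause puts [u] at distance exactly [n], so that iterating traces back a geodesic. *)
Lemma ball_pred n x v : v \in ball n.+1 x -> v \notin ball n x ->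
  exists u, [/\ u \in ball n x, u -- v & forall m, m.+1 <= n -> u \notin ball m x].
Proof.
case/bigcupP=> u ux; rewrite !inE => /orP[/eqP-> /negP //|/andP[vY uv] vx].
exists u; split=> // m mn; apply: contra vx => /ball_step/(_ vY uv).
by elim: n mn {ux} => // n IH; rewrite ltnS leq_eqVlt => /predU1P[-> //|/IH mn /mn /ballS].
Qed.

(** A geodesic leading out of the ball would be an induced P5. *)
Lemma ball3_closed x u v : x \in Y -> u \in ball 3 x -> v \in Y -> u -- v -> v \in ball 3 x.
Proof.
move=> xY ux vY uv; apply: contraPT noP5 => v3 [].
have [u3 [u33 u3v u3m]] := ball_pred (ball_step ux vY uv) v3.
have [u2 [u22 u23 u2m]] := ball_pred u33 (u3m 2 isT).
have [u1 [u11 u12 u1m]] := ball_pred u22 (u2m 1 isT).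
have [u0 [u00 u01 _]] := ball_pred u11 (u1m 0 isT).
have u3Y := ball_sub xY u33; have u2Y := ball_sub xY u22.
have far n w w' : w \in ball n x -> w' \in Y -> w' \notin ball n.+1 x -> ~~ w -- w'.
  by move=> wn w'Y; apply: contra; apply: ball_step.
have v2 : v \notin ball 2 x by apply: contra v3; apply: ballS.
have v1 : v \notin ball 1 x by apply: contra v2; apply: ballS.
apply: (@induced_P5 _ _ u0 u1 u2 u3 v) => //.
- by apply: (far 0) => //; apply: u2m.
- by apply: (far 0) => //; apply: u3m.
- exact: (far 0).
- by apply: (far 1) => //; apply: u3m.
- exact: (far 1).
- exact: (far 2).
Qed.

Let r : rel T := [rel u v | [&& u \in Y, v \in Y & u -- v]].

Lemma r_connect_sym : connect_sym r.
Proof. by apply: sym_connect_sym => u v; rewrite /r /= symG andbCA. Qed.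

Let comp x := [set w | connect r x w].

Lemma comp_card x : x \in Y -> #|comp x| <= 5 ^ 3.
Proof.
move=> xY; apply: leq_trans (ball_card 3 xY); apply: subset_leq_card.
apply/subsetP => w; rewrite inE; apply: (connect_invariant (P := [in ball 3 x])).
  by do 3!apply: ballS; rewrite inE.
by move=> u v uB /and3P[uY vY]; apply: ball3_closed.
Qed.

Lemma comp_sub x u : x \in Y -> u \in comp x -> u \in Y.
Proof.
by move=> xY; rewrite inE; apply: (connect_invariant (P := [in Y])) => // v w _ /and3P[].
Qed.

Lemma comp_step x u v : x \in Y -> u \in comp x -> v \in Y -> u -- v -> v \in comp x.
Proof.
move=> xY uK vY uv; have uY := comp_sub xY uK; rewrite inE in uK.
by rewrite inE (connect_trans uK) // connect1 // /r /= uY vY.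
Qed.

Let NF x := [set f in F | f -- x].

(* If [f] sees [u] then it misses [v] (no K5), so it sees [w] (no P5 [t f u v w]). *)
Lemma NF_distance2_sub u v w : u \in Y -> v \in Y -> w \in Y -> u -- v -> v -- w ->
  NF u \subset NF w.
Proof.
move=> uY vY wY uv vw; apply/subsetP => f; rewrite !inE => /andP[fF fu]; rewrite fF /=.
apply: contraPT noP5 => fw [].
have uf : u -- f by rewrite symG.
apply: (@induced_P5 _ _ t f u v w) ;
  rewrite ?(tF fF, negbTE (tY uY), negbTE (tY vY), negbTE (tY wY)) //.
- rewrite symG; apply/negP => vf.
  by apply: (class_no_triangle uY vY _ uv vf uf); rewrite inE fF orbT.
- by apply/negP => uw; apply: (class_no_triangle uY vY _ uv vw uw); rewrite inE wY.
Qed.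

Lemma NF_distance2 u v w : u \in Y -> v \in Y -> w \in Y -> u -- v -> v -- w -> NF u = NF w.
Proof.
move=> uY vY wY uv vw; apply/eqP; rewrite eqEsubset.
by rewrite !(@NF_distance2_sub _ v) // symG.
Qed.

(** In a 4-coloring of the graph without [t], the two distinct colors of [c1] and [c2] are absent
    from [Y]. *)
Lemma class_bipartite :
  exists s : T -> bool, forall u v, u \in Y -> v \in Y -> u -- v -> s u != s v.
Proof.
have [Y0|[y0 y0Y]] := set_0Vmem Y; first by exists xpredT => u v; rewrite Y0 inE.
have [c cP] := coloring_off t; exists (fun u => c u == c y0) => u v uY vY uv.
have neqY w : w \in Y -> w != t by apply: contraTneq => ->.
have neqc d : d -- y0 -> d != t by apply: contraTneq => ->; apply: tY.
have [n1 n2] := (neqc _ (c1Y y0Y), neqc _ (c2Y y0Y)).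
have cc : c c1 != c c2 by apply: cP.
have [d1 d2] : (forall w, w \in Y -> c c1 != c w) /\ (forall w, w \in Y -> c c2 != c w).
  by split=> w wY; apply: cP; rewrite ?(neqY _ wY, c1Y wY, c2Y wY).
have cuv : c u != c v by apply: cP; rewrite ?neqY.
by apply: (@ord4_two_left (c c1) (c c2)) => //; rewrite ?(d1, d2).
Qed.

(** The mate stands for the other side of the component. An isolated [x] is its own mate, detected
    by the failure of [r x (mate x)]. *)
Let mate x := odflt x [pick y | r x y].
Let label x := (r x (mate x), NF x, NF (mate x)).

Lemma mate_comp x : mate x \in comp x.
Proof. by rewrite inE /mate; case: pickP => [y /connect1|]. Qed.

Lemma mateP x y : r x y -> r x (mate x).
Proof. by rewrite /mate; case: pickP => // /(_ y) ->. Qed.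

Lemma comp_isolated x u : ~~ r x (mate x) -> u \in comp x -> u = x.
Proof.
move=> iso; rewrite inE => xu; apply/eqP; move: xu.
by apply: (connect_invariant (P := pred1 x)) => //= v w /eqP-> /mateP; rewrite (negbTE iso).
Qed.

Lemma NF_comp (s : T -> bool) x u : (forall u v, u \in Y -> v \in Y -> u -- v -> s u != s v) ->
  u \in comp x -> NF u = NF (if s u == s x then x else mate x).
Proof.
move=> sP ux; have [rx|iso] := boolP (r x (mate x)); last by rewrite (comp_isolated iso ux) eqxx.
have [xY mY xm] := and3P rx.
pose side v := if s v == s x then x else mate x.
have sideN v w : r v w -> NF (side w) = NF (if s v == s x then mate x else x).
  by case/and3P=> vY wY /(sP _ _ vY wY); rewrite /side; do 3![case: (s _)].
(* [NF_distance2] relates vertices two steps apart, so the invariant has to include the neighbors of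
   [v]. *)
pose P v := (NF v == NF (side v)) &&
  [forall w, r v w ==> (NF w == NF (if s v == s x then mate x else x))].
suff : P u by case/andP=> /eqP.
move: ux; rewrite inE; apply: connect_invariant => [|v w /andP[Pv /forallP Pvw] vw].
  rewrite /P /side !eqxx /=; apply/forallP => w; apply/implyP => /and3P[_ wY xw].
  by apply/eqP; apply: (@NF_distance2 _ x) => //; rewrite symG.
have [vY wY v_w] := and3P vw.
rewrite /P (sideN v) // (implyP (Pvw w) vw) /=.
apply/forallP => w'; apply/implyP => /and3P[_ w'Y ww'].
rewrite -(NF_distance2 vY wY w'Y v_w ww') (eqP Pv) /side.
by have := sP _ _ vY wY v_w; do 3![case: (s _)].
Qed.

Lemma no_five_components (x : 'I_5 -> T) :
  (forall a, x a \in Y) -> (forall a b, a != b -> ~~ connect r (x a) (x b)) ->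
  (forall a b, label (x a) = label (x b)) -> False.
Proof.
move=> xY nconn lab; have [s sP] := class_bipartite.
have disj a b u : a != b -> u \in comp (x a) -> u \notin comp (x b).
  move=> ab; rewrite !inE => au; apply: contra (nconn a b ab) => bu.
  by apply: connect_trans au _; rewrite r_connect_sym.
have anti a b u v : a != b -> u \in comp (x a) -> v \in comp (x b) -> ~~ u -- v.
  move=> ab au bv; have vY := comp_sub (xY b) bv; apply: contraTN bv => uv.
  by apply: disj ab _; apply: comp_step uv.
have NFeq a b : NF (x a) = NF (x b) /\ NF (mate (x a)) = NF (mate (x b)).
  by case: (lab a b) => _ -> ->.
(* Such pairs, one for each [b], form the configuration excluded by [no_co_matching]. *)
pose P b p := [/\ p.1 \in comp (x b), ~~ p.2 -- p.1 &
  forall d w, d != b -> w \in comp (x d) -> p.2 -- w].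
have /fin_all_exists[p pP] b : exists p, P b p.
  have [a /andP[ab _]] := exists_ord5_neq2 b b.
  (* [h] folds the component of [x a] onto the edge from [x b] to its mate, or onto an isolated
     [x b], matching sides with equal traces on [F]. *)
  pose h u := if s u == s (x a) then x b else mate (x b).
  have hb u : h u \in comp (x b) by rewrite /h; case: ifP; rewrite ?mate_comp // inE.
  have [|u _|u v ua va uv|u [z [ua zK uz huz]]] :=
    @critical_no_hom (comp (x a)) h (x a).
  - by rewrite inE.
  - by apply: disj (hb u); rewrite eq_sym.
  - have rb : x b -- mate (x b).
      suff /and3P[] : r (x b) (mate (x b)) by [].
      have [-> _ _] := lab b a; apply: contraTT uv => iso.
      by rewrite (comp_isolated iso ua) (comp_isolated iso va) adj_irr.
    have := sP _ _ (comp_sub (xY a) ua) (comp_sub (xY a) va) uv; rewrite /h.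
    by do 3![case: (s _)]; rewrite //= symG.
  have zY : z \notin Y by apply: contra zK => zY; apply: comp_step uz.
  have zF : z \notin F.
    have NFu : NF u = NF (h u).
      by rewrite (NF_comp sP ua) /h; have [NFx NFm] := NFeq a b; case: ifP.
    apply: contra huz => zF; suff : z \in NF (h u) by rewrite inE symG => /andP[].
    by rewrite -NFu inE zF symG.
  have far d e w w' : d != e -> w \in comp (x d) -> w' \in comp (x e) ->
    [/\ w \in Y, w' \in Y, w != w' & ~~ w -- w'].
    move=> de wd we; rewrite (comp_sub (xY d) wd) (comp_sub (xY e) we) (anti _ _ _ _ de wd we).
    by split=> //; apply: contraNneq (disj _ _ _ de wd) => ->.
  have almost d e w w' : d != e -> d != b -> e != b -> w \in comp (x d) -> z -- w ->
    w' \in comp (x e) -> z -- w'.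
    move=> de db eb wd zw we; rewrite symG in huz.
    have [wY w'Y ww' nww'] := far _ _ _ _ de wd we.
    have [_ hY wh nwh] := far _ _ _ _ db wd (hb u).
    have [_ _ w'h nw'h] := far _ _ _ _ eb we (hb u).
    have := auY zY zF wY w'Y hY ww' wh w'h nww' nwh nw'h zw.
    by rewrite (negbTE huz) orbF.
  exists (h u, z); split=> //= [|d w db wd]; first by rewrite symG.
  rewrite symG in uz.
  have [dE|da] := eqVneq d a; last by apply: (almost a d u); rewrite // eq_sym.
  (* A vertex of the component of [x a] may be adjacent to [u], so it is reached through a third
     component. *)
  rewrite {d}dE in db wd; have [e /andP[ea eb]] := exists_ord5_neq2 a b.
  have ze : z -- x e by apply: (almost a e u); rewrite // 1?eq_sym // inE.
  by apply: (almost e a (x e)); rewrite // inE.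
apply: (@no_co_matching (fst \o p) (snd \o p)) => a b /=.
  have [<-|ab] := eqVneq a b; first by rewrite adj_irr.
  by have [[pa _ _] [pb _ _]] := (pP a, pP b); apply: anti ab pa pb.
have [[_ naa pa] [pb _ _]] := (pP a, pP b).
have [<-|ab] := eqVneq a b; first exact: negbTE.
by apply: pa pb; rewrite eq_sym.
Qed.

(** The factors bound, from the right, the vertices in a component, the components with one label,
    and the labels, where [F] has at most [2 ^ 4] subsets. *)
Lemma class_card : #|Y| <= 2 * (2 ^ 4 * 2 ^ 4) * 4 * 5 ^ 3.
Proof.
have rootY y : y \in Y -> root r y \in Y.
  by move=> yY; apply: (comp_sub yY); rewrite inE connect_root.
apply: leq_trans (card_fibers_le (f := root r) (m := 5 ^ 3) _) _ => [y|].
  have [->|[x]] := set_0Vmem [set x in Y | root r x == y]; first by rewrite cards0.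
  rewrite inE => /andP[xY /eqP<-]; apply: leq_trans (comp_card xY).
  apply: subset_leq_card; apply/subsetP => w; rewrite !inE => /andP[_].
  by rewrite (root_connect r_connect_sym) r_connect_sym.
rewrite leq_mul2r; apply/orP; right.
apply: leq_trans (card_fibers_le (f := label) (m := 4) _) _ => [l|].
  rewrite leqNgt; apply/negP => /ord_enum_of_card[x injx xl].
  have xP a : [/\ x a \in Y, root r (x a) = x a & label (x a) = l].
    have := xl a; rewrite inE => /andP[/imsetP[y yY ->] /eqP->].
    by rewrite rootY // root_root //; apply: r_connect_sym.
  apply: (@no_five_components x) => [a|a b ab|a b]; first by case: (xP a).
    rewrite -(root_connect r_connect_sym).
    by have [[_ -> _] [_ -> _]] := (xP a, xP b); rewrite (inj_eq injx).
  by have [[_ _ ->] [_ _ ->]] := (xP a, xP b).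
rewrite leq_mul2r; apply/orP; right.
pose labels := setX (setX [set: bool] (powerset F)) (powerset F).
have : #|label @: (root r @: Y)| <= #|labels|.
  apply: subset_leq_card; apply/subsetP => _ /imsetP[x _ ->].
  by rewrite !inE /=; apply/andP; split; apply/subsetP => f; rewrite inE => /andP[].
rewrite !cardsX cardsT card_bool !card_powerset => /leq_trans; apply.
by rewrite -mulnA leq_mul // leq_mul // leq_pexp2l.
Qed.

End NeighborhoodClass.

(** * Traces on an induced 5-cycle *)

Definition cycle5 v0 v1 v2 v3 v4 :=
  [&& v0 -- v1, v1 -- v2, v2 -- v3, v3 -- v4 & v4 -- v0] &&
  [&& ~~ v0 -- v2, ~~ v1 -- v3, ~~ v2 -- v4, ~~ v3 -- v0 & ~~ v4 -- v1].

Lemma cycle5_rot v0 v1 v2 v3 v4 : cycle5 v0 v1 v2 v3 v4 -> cycle5 v1 v2 v3 v4 v0.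
Proof.
by case/andP=> /and5P[? ? ? ? ?] /and5P[? ? ? ? ?]; apply/andP; split; apply/and5P; split.
Qed.

Lemma cycle5_at v0 v1 v2 v3 v4 c :
  cycle5 v0 v1 v2 v3 v4 -> c \in [:: v0; v1; v2; v3; v4] ->
  exists w1 w2 w3 w4, cycle5 c w1 w2 w3 w4 /\ [:: v0; v1; v2; v3; v4] =i [:: c; w1; w2; w3; w4].
Proof.
move=> C0; have C1 := cycle5_rot C0; have C2 := cycle5_rot C1; have C3 := cycle5_rot C2.
have C4 := cycle5_rot C3; rewrite !inE.
by case/predU1P=> [->|/predU1P[->|/predU1P[->|/predU1P[->|/eqP->]]]];
  do 4!eexists; (split; [eassumption|]) => x; rewrite !inE; do 5!case: (x == _).
Qed.

(** A trace of one vertex or two adjacent ones gives an induced P5; two nonadjacent ones give a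
    chair. *)
Lemma cycle5_few_neighbors v0 v1 v2 v3 v4 z :
  cycle5 v0 v1 v2 v3 v4 -> z \notin [:: v0; v1; v2; v3; v4] -> z -- v0 ->
  1 < z -- v1 + z -- v2 + z -- v3 + z -- v4.
Proof.
case/andP=> /and5P[e01 e12 e23 e34 e40] /and5P[n02 n13 n24 n30 n41].
rewrite !inE !negb_or => /and5P[_ z1 _ _ z4] zv0.
case Z1: (z -- v1); case Z2: (z -- v2); case Z3: (z -- v3); case Z4: (z -- v4) => //; exfalso.
- by apply: noP5; apply: (@induced_P5 _ _ z v1 v2 v3 v4); rewrite ?Z2 ?Z3 ?Z4 // symG.
- by apply: noChair; apply: (@induced_chair _ _ z v2 v3 v4 v1);
     rewrite ?Z1 ?Z3 ?Z4 // symG ?Z1 ?Z3 ?Z4.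
- by apply: noChair; apply: (@induced_chair _ _ z v3 v2 v1 v4);
     rewrite ?Z1 ?Z2 ?Z4 // symG ?Z1 ?Z2 ?Z4.
- by apply: noP5; apply: (@induced_P5 _ _ z v4 v3 v2 v1); rewrite ?Z2 ?Z3 ?Z1 // symG.
by apply: noP5; apply: (@induced_P5 _ _ z v0 v1 v2 v3); rewrite ?Z2 ?Z3 ?Z1 // symG.
Qed.

Lemma cycle5_neighbors v0 v1 v2 v3 v4 z :
  cycle5 v0 v1 v2 v3 v4 -> z \notin [:: v0; v1; v2; v3; v4] ->
  has (adj G z) [:: v0; v1; v2; v3; v4] -> 2 < z -- v0 + z -- v1 + z -- v2 + z -- v3 + z -- v4.
Proof.
move=> C0 zC; have C1 := cycle5_rot C0; have C2 := cycle5_rot C1; have C3 := cycle5_rot C2.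
have C4 := cycle5_rot C3.
have rotC n : z \notin rot n [:: v0; v1; v2; v3; v4] by rewrite mem_rot.
move: (introT implyP (cycle5_few_neighbors C0 (rotC 0))).
move: (introT implyP (cycle5_few_neighbors C1 (rotC 1))).
move: (introT implyP (cycle5_few_neighbors C2 (rotC 2))).
move: (introT implyP (cycle5_few_neighbors C3 (rotC 3))).
move: (introT implyP (cycle5_few_neighbors C4 (rotC 4))).
by rewrite /= orbF; do 5!case: (z -- _).
Qed.

(* Iterated around the cycle, this shows that [w] sees all or none of it. *)
Lemma cycle5_far_neighbor v0 v1 v2 v3 v4 u w :
  cycle5 v0 v1 v2 v3 v4 -> ~~ has (adj G u) [:: v0; v1; v2; v3; v4] ->
  u -- w -> w -- v0 -> w -- v1.
Proof.
case/andP=> /and5P[e01 e12 e23 e34 e40] /and5P[n02 n13 n24 n30 n41].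
rewrite /= orbF !negb_or => /and5P[u0 u1 u2 u3 u4] uw w0; apply: contraT => w1; exfalso.
have uN v : v -- v1 -> u != v by apply: contraTneq => <-.
have [w2|w2] := boolP (w -- v2); last first.
  by apply: noP5; apply: (@induced_P5 _ _ u w v0 v1 v2).
have [w4|w4] := boolP (w -- v4); last first.
  by apply: noChair; apply: (@induced_chair _ _ u w v0 v4 v2); rewrite // ?uN // symG.
have [w3|w3] := boolP (w -- v3); last first.
  by apply: noChair; apply: (@induced_chair _ _ u w v2 v3 v0); rewrite // ?uN // symG.
have u4' : u != v4 by apply: contraTneq e40 => <-.
by apply: noChair; apply: (@induced_chair _ _ u w v2 v1 v4); rewrite // symG.
Qed.

(** Traces have at least three vertices, so [w] misses only [v0] and [z] misses [v0] and one more.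
    Were [z] and [w] nonadjacent, there would be a P5 if that vertex is next to [v0], and a chair
    otherwise. *)
Lemma cycle5_complete v0 v1 v2 v3 v4 z w :
  cycle5 v0 v1 v2 v3 v4 ->
  z \notin [:: v0; v1; v2; v3; v4] -> has (adj G z) [:: v0; v1; v2; v3; v4] ->
  w \notin [:: v0; v1; v2; v3; v4] -> has (adj G w) [:: v0; v1; v2; v3; v4] ->
  ~~ w -- v0 -> (forall c, c \in [:: v0; v1; v2; v3; v4] -> z -- c -> w -- c) ->
  (exists2 c, c \in [:: v0; v1; v2; v3; v4] & w -- c && ~~ z -- c) -> z -- w.
Proof.
move=> cyc zC hz wC hw w0 zw [c cC /andP[wc zc]].
have z0 : ~~ z -- v0 by apply: contra w0; apply: zw; rewrite inE eqxx.
have strict : [|| w -- v1 && ~~ z -- v1, w -- v2 && ~~ z -- v2, w -- v3 && ~~ z -- v3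
                | w -- v4 && ~~ z -- v4].
  move: cC wc zc; rewrite !inE => /predU1P[->|]; first by rewrite (negbTE w0).
  by case/predU1P=> [->|/predU1P[->|/predU1P[->|/eqP->]]] -> ->; rewrite ?orbT.
have le_zw c' : c' \in [:: v0; v1; v2; v3; v4] -> z -- c' ==> w -- c'.
  by move=> c'C; apply/implyP; apply: zw.
move: (le_zw v1) (le_zw v2) (le_zw v3) (le_zw v4); rewrite !inE !eqxx !orbT.
move: strict (cycle5_neighbors cyc zC hz) (cycle5_neighbors cyc wC hw).
rewrite (negbTE z0) (negbTE w0).
case/andP: cyc => /and5P[e01 e12 e23 e34 e40] /and5P[n02 n13 n24 n30 n41].
have v0z : v0 != z by move: zC; rewrite !inE !negb_or eq_sym => /andP[].
case Z1: (z -- v1); case Z2: (z -- v2); case Z3: (z -- v3); case Z4: (z -- v4) => //;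
  case W1: (w -- v1); case W2: (w -- v2); case W3: (w -- v3); case W4: (w -- v4) => //;
  try (by move=> _ _ _ /(_ isT)); try (by move=> _ _ _ _ /(_ isT));
  try (by move=> _ _ _ _ _ /(_ isT)); try (by move=> _ _ _ _ _ _ /(_ isT));
  move=> _ _ _ _ _ _ _; apply: contraT => zw'; exfalso.
- by apply: noP5; apply: (@induced_P5 _ _ v0 v4 w v2 z);
     rewrite ?(Z1, Z2, Z3, Z4) // symG ?(Z1, Z2, Z3, Z4).
- by apply: noChair; apply: (@induced_chair _ _ v0 v1 w v3 z);
     rewrite ?(Z1, Z2, Z3, Z4) // symG ?(Z1, Z2, Z3, Z4).
- by apply: noChair; apply: (@induced_chair _ _ v0 v4 w v2 z);
     rewrite ?(Z1, Z2, Z3, Z4) // symG ?(Z1, Z2, Z3, Z4).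
by apply: noP5; apply: (@induced_P5 _ _ v0 v1 w v3 z);
     rewrite ?(Z1, Z2, Z3, Z4) // symG ?(Z1, Z2, Z3, Z4).
Qed.

(** * Vertices seeing none or all of the cycle *)

Variables v0 v1 v2 v3 v4 : T.
Hypothesis cyc : cycle5 v0 v1 v2 v3 v4.

Let C := [:: v0; v1; v2; v3; v4].
Let F := [set z | all (adj G z) C].

Lemma mem_cycle : [/\ v0 \in C, v1 \in C, v2 \in C, v3 \in C & v4 \in C].
Proof. by split; rewrite !inE eqxx ?orbT. Qed.

(** Any three vertices of a 5-cycle include two consecutive ones. *)
Lemma cycle5_edge z : z \notin C -> has (adj G z) C ->
  exists c1 c2, [/\ c1 \in C, c2 \in C, c1 -- c2, z -- c1 & z -- c2].
Proof.
move=> zC /(cycle5_neighbors cyc zC) cnt; case/andP: cyc => /and5P[e01 e12 e23 e34 e40] _.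
have [? ? ? ? ?] := mem_cycle.
have [|n01] := boolP (z -- v0 && z -- v1); first by case/andP; exists v0, v1.
have [|n12] := boolP (z -- v1 && z -- v2); first by case/andP; exists v1, v2.
have [|n23] := boolP (z -- v2 && z -- v3); first by case/andP; exists v2, v3.
have [|n34] := boolP (z -- v3 && z -- v4); first by case/andP; exists v3, v4.
have [|n40] := boolP (z -- v4 && z -- v0); first by case/andP; exists v4, v0.
by move: cnt n01 n12 n23 n34 n40; do 5!case: (z -- _).
Qed.

(** Two colors on [F] would leave only two colors for the odd cycle. *)
Lemma F_monochromatic (c : T -> 'I_4) x f f' :
  (forall u v, u != x -> v != x -> u -- v -> c u != c v) ->
  x \notin C -> f \in F -> f' \in F -> f != x -> f' != x -> c f = c f'.
Proof.
move=> cP xC; rewrite !inE => /allP fF /allP f'F fx f'x; apply/eqP; apply: contraT => cff'.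
have neq v : v \in C -> v != x by apply: contraTneq => ->.
have s2 u v : u \in C -> v \in C -> u -- v -> (c u == c v0) != (c v == c v0).
  have v0C : v0 \in C by rewrite inE eqxx.
  move=> uC vC uv; apply: (ord4_two_left cff'); apply: cP;
  by rewrite ?(neq _ uC, neq _ vC, neq _ v0C, fF, f'F).
case/andP: cyc => /and5P[e01 e12 e23 e34 e40] _.
have [m0 m1 m2 m3 m4] := mem_cycle.
move: (s2 _ _ m0 m1 e01) (s2 _ _ m1 m2 e12) (s2 _ _ m2 m3 e23).
move: (s2 _ _ m3 m4 e34) (s2 _ _ m4 m0 e40).
by do 5!case: (_ == c v0).
Qed.

Lemma notin_C z : ~~ has (adj G z) C -> z \notin C.
Proof.
case/andP: cyc => /and5P[e01 e12 e23 e34 e40] _; have [m0 m1 m2 m3 m4] := mem_cycle.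
move/hasPn=> zN; apply/negP; rewrite !inE.
case/predU1P=> [zE|/predU1P[zE|/predU1P[zE|/predU1P[zE|/eqP zE]]]].
- by have := zN _ m1; rewrite zE e01.
- by have := zN _ m2; rewrite zE e12.
- by have := zN _ m3; rewrite zE e23.
- by have := zN _ m4; rewrite zE e34.
by have := zN _ m0; rewrite zE e40.
Qed.

Lemma far_neighbor u w : ~~ has (adj G u) C -> u -- w -> has (adj G w) C -> w \in F.
Proof.
move=> uN uw wC; have [c0 c1] := (cyc, cycle5_rot cyc); have c2 := cycle5_rot c1.
have c3 := cycle5_rot c2; have c4 := cycle5_rot c3.
have rotC n : ~~ has (adj G u) (rot n C) by rewrite has_rot.
move: (introT implyP (cycle5_far_neighbor c0 (rotC 0) uw)).
move: (introT implyP (cycle5_far_neighbor c1 (rotC 1) uw)).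
move: (introT implyP (cycle5_far_neighbor c2 (rotC 2) uw)).
move: (introT implyP (cycle5_far_neighbor c3 (rotC 3) uw)).
move: (introT implyP (cycle5_far_neighbor c4 (rotC 4) uw)).
by move: wC; rewrite inE /= orbF andbT; do 5!case: (w -- _).
Qed.

(* A vertex [f] in [F] has the same neighbors in a component of the vertices far from the
   cycle, so a coloring of the component can be realigned with a coloring in which [F] is
   monochromatic. *)
Lemma no_far_vertex x : has (adj G x) C.
Proof.
apply: contraT => xN; exfalso.
pose S0 z := ~~ has (adj G z) C.
have S0F z w : S0 z -> ~~ S0 w -> z -- w -> w \in F.
  by move=> zN /negbNE wC zw; apply: far_neighbor zw wC.
have [m0 m1 m2 m3 m4] := mem_cycle.
(* Otherwise [f] with leaves [v0], [v2] and the path through [z] to [w] is a chair. *)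
have sameF z w f : S0 z -> S0 w -> z -- w -> f \in F -> z -- f -> w -- f.
  rewrite inE => /hasPn zN /hasPn wN zw /allP fC zf; apply: contraPT noChair => wf [].
  case/andP: cyc => /and5P[_ _ _ _ e40] /and5P[n02 _ n24 _ _].
  have v02 : v0 != v2 by apply: contraNneq n24 => <-; rewrite symG.
  apply: (@induced_chair _ _ v0 f z w v2); rewrite ?(fC _ m0, fC _ m2) //.
  - by rewrite symG.
  - by rewrite symG zN.
  - by rewrite symG zN.
  - exact: wN.
  - exact: wN.
have [al alP] := coloring_off x; have [be beP] := coloring_off v0.
(* [be] is proper on far vertices and [F]. The transposition, constant on a far component, sends the
   [be] color of [f] to the one color that [al] uses on [F]. *)
pose ga z := if S0 z then
    if [pick f | (f \in F) && (z -- f)] is Some f then tperm (be f) (al f) (be z) else be z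
  else al z.
have S0v0 z : S0 z -> z != v0 by move/notin_C; apply: contraNneq => ->.
have Fv0 f : f \in F -> f != v0.
  by rewrite inE => /allP/(_ _ m0); apply: contraTneq => ->; rewrite adj_irr.
have FS0 f : f \in F -> ~~ S0 f.
  by rewrite inE negbK => /allP fC; apply/hasP; exists v0; rewrite ?fC.
have nS0x z : ~~ S0 z -> z != x by apply: contraNneq => ->.
have cross z w : S0 z -> ~~ S0 w -> z -- w -> ga z != ga w.
  move=> z0 w0 zw; rewrite /ga z0 (negbTE w0); have wF := S0F _ _ z0 w0 zw.
  case: pickP => [f /andP[fF zf]|/(_ w)]; last by rewrite wF zw.
  rewrite (F_monochromatic alP (notin_C xN) wF fF) ?nS0x ?FS0 //.
  rewrite -{2}(tpermL (be f) (al f)) (inj_eq perm_inj); apply: beP zf; auto.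
apply: (@not_4colorable ga) => z w zw.
have [z0|z0] := boolP (S0 z); have [w0|w0] := boolP (S0 w).
- rewrite /ga z0 w0.
  have -> : [pick f | (f \in F) && (w -- f)] = [pick f | (f \in F) && (z -- f)].
    apply: eq_pick => f; have [fF|//] := boolP (f \in F).
    by apply/idP/idP; apply: sameF; rewrite // symG.
  have bzw : be z != be w by apply: beP; rewrite ?S0v0.
  by case: pickP => // f _; rewrite (inj_eq perm_inj).
- exact: cross.
- by rewrite eq_sym cross // symG.
by rewrite /ga (negbTE z0) (negbTE w0); apply: alP; rewrite ?nS0x.
Qed.

(** More than 7 vertices leave some [x] off [C] and distinct from [f] and [f']; a 4-coloring of the
    graph without [x] gives [f] and [f'] one color. *)
Lemma F_independent : 7 < #|T| -> {in F &, forall f f', ~~ f -- f'}.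
Proof.
move=> T7 f f' fF f'F; apply/negP => ff'.
have : 0 < #|~: [set:: f :: f' :: C]|.
  rewrite -(ltn_add2l #|[set:: f :: f' :: C]|) addn0 cardsC; apply: leq_ltn_trans T7.
  by rewrite cardsE card_size.
case/card_gt0P=> x; rewrite in_setC in_set 2!in_cons => /norP[xf /norP[xf' xC]].
have [c cP] := coloring_off x.
have := cP f f'; rewrite eq_sym xf eq_sym xf' ff' => /(_ isT isT isT)/eqP[].
by apply: (F_monochromatic cP xC fF f'F); rewrite eq_sym.
Qed.

Lemma F_card : 7 < #|T| -> #|F| <= 4.
Proof.
move=> /F_independent indF; apply: independent_le4 => // z.
rewrite inE => /allPn[c cC zc]; apply: (almost_uniform_chair _ zc) => f.
by rewrite in_set symG => /allP/(_ _ cC).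
Qed.

(** * Counting vertices by trace *)

Let trace z := [set c in C | z -- c].

Lemma trace_fiber z0 : 7 < #|T| -> z0 \notin C -> z0 \notin F ->
  #|[set z in ~: [set:: C] | trace z == trace z0]| <= 2 * (2 ^ 4 * 2 ^ 4) * 4 * 5 ^ 3.
Proof.
move=> T7 z0C z0F; set Y := [set z in _ | _].
have YP z : z \in Y -> z \notin C /\ forall c, c \in C -> z -- c = z0 -- c.
  rewrite in_set in_setC in_set => /andP[zC /eqP/setP zz0]; split=> // c cC.
  by have := zz0 c; rewrite !in_set cC.
have [c1 [c2 [c1C c2C c12 zc1 zc2]]] := cycle5_edge z0C (no_far_vertex z0).
have [t tC z0t] : exists2 t, t \in C & ~~ z0 -- t by move: z0F; rewrite inE => /allPn.
have FC c f : c \in C -> f \in F -> c -- f by move=> cC; rewrite in_set symG => /allP/(_ _ cC).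
have YC c y : c \in C -> y \in Y -> c -- y = z0 -- c by move=> cC /YP[_ yC]; rewrite symG yC.
apply: (@class_card F Y c1 c2 t) => // [f|f|f|y yY|y yY|y yY|| z zY zF|].
- exact: FC.
- exact: FC.
- exact: FC.
- by rewrite YC.
- by rewrite YC.
- by rewrite YC.
- by apply/negP => /YP[]; rewrite tC.
- have [zC|zC] := boolP (z \in C).
    by apply: (@almost_uniform_const _ _ (z0 -- z)) => y; apply: YC.
  have [/hasP[c cC /andP[z0c zc]]|sub] := boolP (has (fun c => z0 -- c && ~~ z -- c) C).
    by apply: almost_uniform_chair zc => y yY; rewrite YC.
  have le_z0z c : c \in C -> z0 -- c -> z -- c.
    by move=> cC z0c; have := hasPn sub c cC; rewrite z0c negbK.
  have [s sC zs] : exists2 s, s \in C & ~~ z -- s by move: zF; rewrite inE => /allPn.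
  have [d dC /andP[zd z0d]] : exists2 d, d \in C & z -- d && ~~ z0 -- d.
    apply/hasP; apply: contraR zY => /hasPn noD; rewrite in_set in_setC in_set zC /=.
    apply/eqP/setP => c; rewrite !in_set; have [cC|//] := boolP (c \in C).
    apply/idP/idP => /=; last exact: le_z0z.
    by move=> zc; have := noD c cC; rewrite zc negbK.
  apply: (@almost_uniform_const _ _ true) => y yY; have [yC yE] := YP _ yY.
  (* Rotating the cycle to start at [s], which [z] misses, lets [z] play the role of [w] in
     [cycle5_complete]. *)
  have [w1 [w2 [w3 [w4 [cycs CE]]]]] := cycle5_at cyc sC.
  rewrite symG; apply: (cycle5_complete cycs) => //.
  - by rewrite -CE.
  - by rewrite -(eq_has_r CE) no_far_vertex.
  - by rewrite -CE.
  - by rewrite -(eq_has_r CE) no_far_vertex.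
  - by move=> c; rewrite -CE => cC; rewrite yE //; apply: le_z0z.
  by exists d; rewrite -?CE // zd yE.
exact: F_card.
Qed.

(** Five cycle vertices, at most [2 ^ 5] traces, and for each trace a fiber inside [F] or bounded by
    [trace_fiber]; the sum covers both cases. *)
Lemma critical_card : 7 < #|T| -> #|T| <= 5 + 2 ^ 5 * (4 + 2 * (2 ^ 4 * 2 ^ 4) * 4 * 5 ^ 3).
Proof.
move=> T7; have C5 : #|[set:: C]| <= 5 by rewrite cardsE card_size.
rewrite -(cardsC [set:: C]); apply: leq_add => //.
set m := 4 + _; apply: leq_trans (card_fibers_le (f := trace) (m := m) _) _ => [y|].
  have [->|[z0]] := set_0Vmem [set x in ~: [set:: C] | trace x == y]; first by rewrite cards0.
  rewrite in_set in_setC in_set => /andP[z0C /eqP<-].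
  have [z0F|z0F] := boolP (z0 \in F); last first.
    by apply: leq_trans (leq_addl _ _); apply: trace_fiber.
  apply: leq_trans (leq_addr _ _); apply: leq_trans (F_card T7).
  apply: subset_leq_card; apply/subsetP => z; rewrite !in_set => /andP[_ /eqP/setP zz0].
  apply/allP => c cC; have := zz0 c; rewrite !in_set cC /= => ->.
  by move: z0F; rewrite in_set => /allP; apply.
rewrite leq_mul2r; apply/orP; right.
have : #|trace @: ~: [set:: C]| <= #|powerset [set:: C]|.
  apply: subset_leq_card; apply/subsetP => _ /imsetP[z _ ->].
  by rewrite inE; apply/subsetP => c; rewrite !in_set => /andP[].
by rewrite card_powerset => /leq_trans; apply; rewrite leq_pexp2l.
Qed.

End CriticalGraph.

Theorem theorem3p1 :
  exists N : nat, forall (T : finType) (G : sgraph T),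
    vertex_critical G 5 ->
    ~ contains_induced G P5 ->
    ~ contains_induced G chair ->
    contains_induced G C5 ->
    #|T| <= N.
Proof.
(* The leading 7 covers the graphs too small for [critical_card]. *)
exists (7 + (5 + 2 ^ 5 * (4 + 2 * (2 ^ 4 * 2 ^ 4) * 4 * 5 ^ 3))) =>
  T G critG noP5 noChair [g [_ gE]].
have [T7|T7] := leqP #|T| 7; first by apply: leq_trans T7 (leq_addr _ _).
apply: leq_trans (leq_addl _ _); apply: (@critical_card T G critG noP5 noChair
  (g (inord 0)) (g (inord 1)) (g (inord 2)) (g (inord 3)) (g (inord 4))) => //.
by rewrite /cycle5 !gE /C5 !inordK.
Qed.
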